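(* Let $R$ be a ring and let $n\ge 2$ be an integer. Then the ring $M_n(R)$ of all $n\times n$ matrices over $R$ is not a $2$-$\sqrt{J}U$ ring.
   Context: All rings are associative with identity $1\neq 0$. For a ring $R$, $J(R)$ denotes the Jacobson radical, $U(R)$ the group of units, and $\sqrt{J(R)}=\{x\in R : x^m\in J(R)\text{ for some } m\ge 1\}$. A ring $R$ is a $2$-$\sqrt{J}U$ ring if $u^2\in 1+\sqrt{J(R)}$ for every $u\in U(R)$. *)

(* Defs.v *)
From HB Require Import structures.
From mathcomp Require Import all_boot all_order all_algebra.
From mathcomp Require Import boolp classical_sets.

Set Implicit Arguments.
Unset Strict Implicit.
Unset Printing Implicit Defensive.

Import GRing.Theory.
Local Open Scope classical_set_scope.
Local Open Scope ring_scope.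

(* The carrier is a pzRingType (1 = 0 allowed) because that is the structure
   which 'M[R]_n carries when n is a variable.  Negatives belong to a left
   ideal because - x = (- 1) * x. *)
Definition left_ideal (R : pzRingType) (I : set R) : Prop :=
  [/\ I 0,
      forall x y, I x -> I y -> I (x + y) &
      forall a x, I x -> I (a * x)].

Definition maximal_left_ideal (R : pzRingType) (M : set R) : Prop :=
  [/\ left_ideal M,
      M <> [set: R] &
      forall I : set R, left_ideal I -> M `<=` I -> I <> [set: R] -> I = M].

Definition jacobson (R : pzRingType) : set R :=
  \bigcap_(M in @maximal_left_ideal R) M.

Definition sqrt_jacobson (R : pzRingType) : set R :=
  [set x | exists2 m : nat, (1 <= m)%N & jacobson (x ^+ m)].

(* GRing.unit is not available: it requires a decidable unit predicate, and
   matrices over a noncommutative ring have no unitRingType structure. *)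
Definition two_sided_unit (R : pzRingType) : set R :=
  [set u | exists v : R, u * v = 1 /\ v * u = 1].

Definition two_sqrtJU (R : pzRingType) : Prop :=
  forall u : R, two_sided_unit u ->
    exists2 x : R, sqrt_jacobson x & u ^+ 2 = 1 + x.

(* Main.v *)
Require Import Defs.
From HB Require Import structures.
From mathcomp Require Import all_boot all_order all_algebra.
From mathcomp Require Import boolp classical_sets.

(** The golden-ratio matrix [[1, 1], [1, 0]] satisfies U ^ 2 = U + 1, so U is a
    unit whose square differs from 1 by the unit U.  For arbitrary n >= 2 it is
    placed in the upper left corner: with e the idempotent diag(1, 1, 0, ..., 0)
    and w the matrix U extended by zeros, u = 1 - e + w is a unit and
    u ^ 2 = 1 + w.  If a power of w were in the Jacobson radical, so would be e,
    because w is invertible in the corner ring cut out by e; but the radical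
    contains no nonzero idempotent.

    The lemma [not_two_sqrtJU_golden] carries this out in an arbitrary ring
    containing such e and w.  The statement on idempotents rests on the
    existence of maximal left ideals, obtained from Zorn's lemma, which makes
    1 - x left invertible for every x in the radical. *)

Set Implicit Arguments.
Unset Strict Implicit.
Unset Printing Implicit Defensive.

Import GRing.Theory.
Local Open Scope ring_scope.

Lemma left_ideal_properE (R : pzRingType) (I : set R) :
  left_ideal I -> I <> [set: R]%classic <-> ~ I 1.
Proof.
move=> [_ _ IM]; split=> [Iproper I1|nI1 IT]; last by apply: nI1; rewrite IT.
apply: Iproper; apply/seteqP; split=> // x _.
by rewrite -[x]mulr1; apply: IM.
Qed.

Lemma left_ideal_sub_maximal (R : pzRingType) (I : set R) :
  left_ideal I -> ~ I 1 ->
  exists2 M : set R, maximal_left_ideal M & (I `<=` M)%classic.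
Proof.
move=> idI nI1; have [I0 ID IM] := idI.
(* Zorn's lemma on unions also asks for the union of the empty chain; hence the
   sets A ranged over are those for which I `|` A is a proper left ideal. *)
pose P : set (set R) := fun A =>
  left_ideal (I `|` A)%classic /\ ~ (I `|` A)%classic 1.
have chainP F : (F `<=` P)%classic -> total_on F subset ->
    P (\bigcup_(X in F) X)%classic.
  move=> FP totF; split; last first.
    by move=> [//|[X FX X1]]; apply: (FP X FX).2; right.
  have inF X x : F X -> (I `|` X)%classic x ->
      (I `|` \bigcup_(X in F) X)%classic x.
    by move=> FX [Ix|Xx]; [left | right; exists X].
  split; first by left.
    move=> x y [Ix|[X FX Xx]] [Iy|[Y FY Yy]].
    - by left; apply: ID.
    - have [[_ YD _] _] := FP Y FY.
      by apply: (inF Y) => //; apply: YD; [left | right].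
    - have [[_ XD _] _] := FP X FX.
      by apply: (inF X) => //; apply: XD; [right | left].
    - have [XY|YX] := totF X Y FX FY.
        have [[_ YD _] _] := FP Y FY.
        by apply: (inF Y) => //; apply: YD; right => //; apply: XY.
      have [[_ XD _] _] := FP X FX.
      by apply: (inF X) => //; apply: XD; right => //; apply: YX.
  move=> a x [Ix|[X FX Xx]]; first by left; apply: IM.
  have [[_ _ XM] _] := FP X FX.
  by apply: (inF X) => //; apply: XM; right.
have [A [[idM nM1] maxA]] := Zorn_bigcup chainP.
exists (I `|` A)%classic; last by move=> x Ix; left.
split=> //; first exact/left_ideal_properE.
move=> K idK MK Kproper.
have IK : (I `|` K)%classic = K by apply/setUidPr => x Ix; apply: MK; left.
have PK : P K by rewrite /P IK; split=> //; apply/left_ideal_properE.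
have AK : (A `<=` K)%classic by move=> x Ax; apply: MK; right.
apply/seteqP; split=> //.
apply: contrapT => nKM; apply: (maxA K) => //; split=> // KA.
by apply: nKM => x Kx; right; apply: KA.
Qed.

Lemma jacobsonM (R : pzRingType) (a x : R) :
  jacobson x -> jacobson (a * x).
Proof.
by move=> Jx M maxM; have [[_ _ MM] _ _] := maxM; apply: MM; apply: Jx.
Qed.

Lemma jacobson_left_inv (R : pzRingType) (x : R) :
  jacobson x -> exists y, y * (1 - x) = 1.
Proof.
move=> Jx; apply: contrapT => noinv.
pose I : set R := fun z => exists y, z = y * (1 - x).
have idI : left_ideal I.
  split; first by exists 0; rewrite mul0r.
    by move=> _ _ [y ->] [z ->]; exists (y + z); rewrite mulrDl.
  by move=> a _ [y ->]; exists (a * y); rewrite mulrA.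
have nI1 : ~ I 1 by move=> [y y1]; apply: noinv; exists y.
have [M maxM IM] := left_ideal_sub_maximal idI nI1.
have [idM Mproper _] := maxM; have [_ MD _] := idM.
have /(left_ideal_properE idM) := Mproper; apply.
rewrite -[1](subrK x); apply: MD; last exact: Jx.
by apply: IM; exists 1; rewrite mul1r.
Qed.

Lemma jacobson_idem (R : pzRingType) (e : R) :
  e * e = e -> jacobson e -> e = 0.
Proof.
move=> ee /jacobson_left_inv[y y1].
by rewrite -[e]mul1r -y1 -mulrA mulrBl mul1r ee subrr mulr0.
Qed.

(** The hypotheses say that e is an idempotent and that w is a root of
    X ^ 2 - X - 1 in the corner ring e R e. *)
Lemma not_two_sqrtJU_golden (R : pzRingType) (e w : R) :
  e != 0 -> e * e = e -> e * w = w -> w * e = w -> w * w = w + e ->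
  ~ two_sqrtJU R.
Proof.
move=> /eqP e0 ee ew we ww JU.
(* w - e is the inverse of w in the corner ring. *)
have vw : (w - e) * w = e by rewrite mulrBl ww ew addrC addKr.
have wv : w * (w - e) = e by rewrite mulrBr ww we addrC addKr.
have corner a b : e * a = a -> b * e = b ->
    (1 - e + b) * (1 - e + a) = 1 - e + b * a.
  move=> ea be.
  rewrite mulrDl mulrBl mul1r !mulrDr !mulrN !mulr1 ee ea be.
  by rewrite !subrr !add0r addrK.
have uU : two_sided_unit (1 - e + w).
  exists (1 - e + (w - e)).
  by rewrite !corner ?vw ?wv ?subrK ?mulrBl ?mulrBr ?ew ?we ?ee.
have [x [m m1 Jxm] uE] := JU _ uU.
have {uE} xE : x = w.
  apply: (@addrI _ 1); rewrite -uE expr2 corner // ww.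
  by rewrite [w + e]addrC addrA subrK.
have eX k : (0 < k)%N -> e ^+ k = e.
  by case: k => // k _; elim: k => [|k IH]; rewrite ?expr1 // exprS IH.
apply/e0/(jacobson_idem ee).
rewrite -(eX m) // -vw exprMn_comm; last by rewrite /GRing.comm vw wv.
by apply: jacobsonM; rewrite -xE.
Qed.

Theorem theorem3p1 (R : nzRingType) (n : nat) (hn : (2 <= n)%N) :
  ~ two_sqrtJU 'M[R]_n.
Proof.
case: n hn => [|[|n]] // _.
pose i : 'I_n.+2 := ord0; pose j : 'I_n.+2 := lift ord0 ord0.
pose d a b : 'M[R]_n.+2 := delta_mx a b.
have dM a b c k : d a b * d c k = d a k *+ (b == c) by exact: mul_delta_mx_cond.
have [ii jj ij ji] : [/\ i == i, j == j, (i == j) = false & (j == i) = false].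
  by [].
apply: (@not_two_sqrtJU_golden _ (d i i + d j j) (d i i + d i j + d j i)).
- apply/eqP => /matrixP/(_ i i)/eqP.
  by rewrite !mxE ii ij /= addr0 oner_eq0.
all: rewrite !mulrDl !mulrDr !dM ii jj ij ji !mulr0n !mulr1n ?addr0 ?add0r //.
by rewrite addrACA.
Qed.
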